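(* The functions $R_F(x,y,z)$, $R_D(x,y,z)$, $R_J(x,y,z,p)$ and $(xyz)^{-1/2}$ are linearly independent with respect to coefficients that are rational functions of $x,y,z,p$. That is, if $\alpha,\beta,\gamma,\delta$ are rational functions of $x,y,z,p$ such that $$\alpha\, R_F(x,y,z)+\beta\, R_D(x,y,z)+\gamma\, R_J(x,y,z,p)+\delta\,(xyz)^{-1/2}\equiv 0$$ identically in the variables, then $\alpha,\beta,\gamma,\delta$ are all identically $0$.
   Context: For $x,y,z\ge 0$ with at most one of them zero, and $p>0$: $R_F(x,y,z)=\frac12\int_0^\infty[(t+x)(t+y)(t+z)]^{-1/2}\,dt$; $R_J(x,y,z,p)=\frac32\int_0^\infty[(t+x)(t+y)(t+z)]^{-1/2}(t+p)^{-1}\,dt$; $R_D(x,y,z)=R_J(x,y,z,z)=\frac32\int_0^\infty[(t+x)(t+y)]^{-1/2}(t+z)^{-3/2}\,dt$ (for $z>0$). *)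

(* Defs.v *)
From HB Require Import structures.
From mathcomp Require Import all_boot all_order all_algebra.
From mathcomp Require Import all_classical all_reals all_analysis.
From mathcomp Require mpoly.
Import (canonicals, coercions) mpoly.
Set Implicit Arguments. Unset Strict Implicit. Unset Printing Implicit Defensive.
Import Order.TTheory GRing.Theory Num.Theory.
Local Open Scope classical_set_scope.
Local Open Scope ring_scope.

Section Carlson.
Variable R : realType.

Definition RF (x y z : R) : R :=
  Rintegral (@lebesgue_measure R) `[0%R, +oo[
    (fun t => 2^-1 * (Num.sqrt ((t + x) * (t + y) * (t + z)))^-1).

Definition RJ (x y z p : R) : R :=
  Rintegral (@lebesgue_measure R) `[0%R, +oo[
    (fun t => 3 / 2 * (Num.sqrt ((t + x) * (t + y) * (t + z)))^-1 * (t + p)^-1).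

Definition RD (x y z : R) : R := RJ x y z z.

Definition pt4 (x y z p : R) : 'I_4 -> R := fun i => nth 0 [:: x; y; z; p] i.

Definition rat_eval (P Q : mpoly.mpoly 4 R) (x y z p : R) : R :=
  mpoly.meval (pt4 x y z p) P / mpoly.meval (pt4 x y z p) Q.

End Carlson.

(* Main.v *)
(* After clearing denominators the claim concerns polynomial coefficients A, B,
   C, D. For fixed x, y, z, as p -> 0+ we have RJ -> +oo while p RJ -> 0, so no
   nonzero polynomial in p times RJ is a polynomial in p: powers of p can be
   divided out of C indefinitely, hence C = 0.
   For the remaining three functions put x = s c^2, z = s with 0 < c < 1, keep
   y and p fixed, and let s -> 0+. Then
     RF -> +oo,   s RF -> 0,   s RD -> 3 / ((1 + c) sqrt y),
     s / sqrt (x y z) = 1 / (c sqrt y).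
   Multiplying the relation by s and passing to the limit gives
     3 c B0(c^2) + (1 + c) D0(c^2) = 0
   for the constant terms in s of B and D; as B0 and D0 are polynomials in c^2,
   both vanish, i.e. s divides B and D. Now all terms but A RF stay bounded, so
   A0 = 0 too, and the relation can be divided by s; one descends. *)
Require Import Defs.
From HB Require Import structures.
From mathcomp Require Import all_boot all_order all_algebra.
From mathcomp Require Import all_classical all_reals all_analysis.
From mathcomp Require Import measurable_realfun ring lra.
From mathcomp Require mpoly.
Import (canonicals, coercions) mpoly.
Import Order.TTheory GRing.Theory Num.Theory.
Import numFieldNormedType.Exports.
Local Open Scope ring_scope.

(** * Comparison of integrals over the half-line, and two elementary integrals *)

Section Integrals.
Set Implicit Arguments. Unset Strict Implicit. Unset Printing Implicit Defensive.
Context {R : realType}.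
Local Open Scope classical_set_scope.
Implicit Types (f g F : R -> R) (q a b k l v : R).

Local Notation mu := (@lebesgue_measure R).
Local Notation ray := (`[0%R, +oo[%classic : set R).

Definition ray_continuous f := forall t : R, 0 <= t -> {for t, continuous f}.

Lemma ray_continuous_within f : ray_continuous f -> {within ray, continuous f}.
Proof.
move=> fc; apply: continuous_in_subspaceT => t.
by rewrite inE /= in_itv /= andbT => /fc.
Qed.

Lemma ray_continuous_measurable f : ray_continuous f -> measurable_fun ray f.
Proof.
move=> fc; apply: subspace_continuous_measurable_fun => //.
exact: ray_continuous_within.
Qed.

Lemma integral_ray_antiderivative f F l :
  (forall t : R, 0 <= t -> 0 <= f t) -> ray_continuous f ->
  (forall t : R, 0 <= t -> is_derive t 1 F (f t)) ->
  F t @[t --> +oo] --> l ->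
  (\int[mu]_(t in ray) (f t)%:E = (l - F 0)%:E)%E.
Proof.
move=> f0 fc dF Fl.
rewrite EFinB; apply: (ge0_continuous_FTC2y (F := F)) => //.
- exact: ray_continuous_within.
- by move=> t t0; have := dF _ (ltW t0) => -[].
- apply: cvg_at_right_filter; have [dF0 _] := dF _ (lexx 0).
  exact/differentiable_continuous/derivable1_diffP.
- move=> t; rewrite in_itv /= andbT => t0.
  by rewrite derive1E; have := dF _ (ltW t0) => -[_ ->].
Qed.

Lemma ray_integralZ g k v : 0 <= k -> (forall t : R, 0 <= t -> 0 <= g t) ->
  ray_continuous g -> (\int[mu]_(t in ray) (g t)%:E = v%:E)%E ->
  (\int[mu]_(t in ray) (k * g t)%:E = (k * v)%:E)%E.
Proof.
move=> k0 g0 gc gv; under eq_integral do rewrite EFinM.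
rewrite ge0_integralZl_EFin ?gv//.
  by move=> t; rewrite /= in_itv /= andbT lee_fin => /g0.
by apply/measurable_EFinP; exact: ray_continuous_measurable.
Qed.

(** Domination by an integrable function makes the extended integral of [f] finite. The first
    conclusion records this: [Rintegral] is then the true value, and not the default taken at an
    infinite integral. *)
Lemma ray_integral_le f g k v : 0 <= k ->
  (forall t : R, 0 <= t -> 0 <= f t <= k * g t) ->
  (forall t : R, 0 <= t -> 0 <= g t) ->
  ray_continuous f -> ray_continuous g ->
  (\int[mu]_(t in ray) (g t)%:E = v%:E)%E ->
  (\int[mu]_(t in ray) (f t)%:E)%E = (Rintegral mu ray f)%:E /\
  0 <= Rintegral mu ray f <= k * v.
Proof.
move=> k0 fg g0 fc gc gv.
have f0 t : ray t -> (0 <= (f t)%:E)%E.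
  by rewrite /= in_itv /= andbT lee_fin => /fg /andP[].
have i0 : (0 <= \int[mu]_(t in ray) (f t)%:E)%E by exact: integral_ge0.
have iv : (\int[mu]_(t in ray) (f t)%:E <= (k * v)%:E)%E.
  rewrite -(ray_integralZ k0 g0 gc gv); apply: ge0_le_integral => //.
  - by apply/measurable_EFinP; exact: ray_continuous_measurable.
  - apply/measurable_EFinP; apply: ray_continuous_measurable => t t0.
    by apply: cvgM; [exact: cvg_cst|exact: gc].
  - by move=> t; rewrite /= in_itv /= andbT lee_fin => /fg /andP[].
rewrite /Rintegral; case: (integral _ _ _) i0 iv => //= r.
by rewrite !lee_fin => -> ->.
Qed.

(** Serves to bound [u] from below by [j * v - k * w]. The additive form keeps every integrand
    nonnegative, so that no integrals are subtracted in the extended reals. *)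
Lemma ray_integral_le_add f g h j k u v w : 0 <= j -> 0 <= k ->
  (forall t : R, 0 <= t -> 0 <= f t) -> (forall t : R, 0 <= t -> 0 <= g t) ->
  (forall t : R, 0 <= t -> 0 <= h t) ->
  ray_continuous f -> ray_continuous g -> ray_continuous h ->
  (forall t : R, 0 <= t -> j * g t <= f t + k * h t) ->
  (\int[mu]_(t in ray) (f t)%:E = u%:E)%E ->
  (\int[mu]_(t in ray) (g t)%:E = v%:E)%E ->
  (\int[mu]_(t in ray) (h t)%:E = w%:E)%E ->
  j * v <= u + k * w.
Proof.
move=> j0 k0 f0 g0 h0 fc gc hc gfh fu gv hw.
have Zc l e : ray_continuous e -> ray_continuous (fun t => l * e t).
  by move=> ec t t0; apply: cvgM; [exact: cvg_cst|exact: ec].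
have mE e : ray_continuous e -> measurable_fun ray e.
  exact: ray_continuous_measurable.
rewrite -lee_fin EFinD -(ray_integralZ j0 g0 gc gv) -(ray_integralZ k0 h0 hc hw) -fu.
rewrite -ge0_integralD//.
- apply: ge0_le_integral => //.
  + by move=> t; rewrite /= in_itv /= andbT lee_fin => t0; rewrite mulr_ge0 ?g0.
  + by apply/measurable_EFinP; apply: mE; exact: Zc.
  + apply/measurable_EFinP; apply: mE => t t0.
    by apply: cvgD; [exact: fc|exact: Zc].
  + by move=> t; rewrite /= in_itv /= andbT lee_fin; exact: gfh.
- by move=> t; rewrite /= in_itv /= andbT lee_fin; exact: f0.
- by apply/measurable_EFinP; exact: mE.
- by move=> t; rewrite /= in_itv /= andbT lee_fin => t0; rewrite mulr_ge0 ?h0.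
- by apply/measurable_EFinP; apply: mE; exact: Zc.
Qed.

(** Only [0, 1] is kept, where [k / (t + q)] has the antiderivative [k * ln (t + q)]. The bound
    blows up logarithmically as q tends to 0, which is the source of both divergences to +oo used
    later. *)
Lemma ray_integral_ge f k q : 0 <= k -> 0 < q ->
  (forall t : R, 0 <= t -> 0 <= f t) -> ray_continuous f ->
  (\int[mu]_(t in ray) (f t)%:E)%E = (Rintegral mu ray f)%:E ->
  (forall t : R, 0 <= t <= 1 -> k / (t + q) <= f t) ->
  k * (ln (1 + q) - ln q) <= Rintegral mu ray f.
Proof.
move=> k0 q0 f0 fc fi kf.
have tq (t : R) : 0 <= t -> 0 < t + q by move=> ?; lra.
have dln (t : R) : 0 <= t -> is_derive t 1 (fun t => k * ln (t + q)) (k / (t + q)).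
  move=> t0; have := is_derive1_ln (tq t t0) => dl.
  have dc : is_derive t 1 (fun t : R => t + q) 1.
    by apply: is_derive_eq; rewrite addr0.
  have := @is_derive1_comp R (fun x => ln x) (fun t => t + q) t _ _ dl dc => dd.
  apply: is_derive_eq; rewrite /GRing.scale /=; ring.
have gc (t : R) : 0 <= t -> {for t, continuous (fun t => k / (t + q))}.
  move=> t0; apply: cvgM; first exact: cvg_cst.
  apply: cvgV; first by rewrite gt_eqF ?tq.
  by apply: cvgD; [exact: cvg_id|exact: cvg_cst].
have fc1 : {within `[0, 1], continuous f}.
  apply: continuous_in_subspaceT => t.
  by rewrite inE /= in_itv /= => /andP[/fc].
have gc1 : {within `[0, 1], continuous (fun t : R => k / (t + q))}.
  apply: continuous_in_subspaceT => t.
  by rewrite inE /= in_itv /= => /andP[/gc].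
have FC (t : R) : 0 <= t -> {for t, continuous (fun t => k * ln (t + q))}.
  by move=> t0; have [? _] := dln _ t0; exact/differentiable_continuous/derivable1_diffP.
have : (\int[mu]_(t in `[0%R, 1%R]) (k / (t + q))%:E <= (Rintegral mu ray f)%:E)%E.
  rewrite -fi; apply: (@le_trans _ _ (\int[mu]_(t in `[0%R, 1%R]) (f t)%:E)%E).
    apply: ge0_le_integral => //.
    - move=> t; rewrite /= in_itv /= => /andP[t0 _].
      by rewrite lee_fin divr_ge0// ltW ?tq.
    - by apply/measurable_EFinP; exact: subspace_continuous_measurable_fun.
    - by apply/measurable_EFinP; exact: subspace_continuous_measurable_fun.
  apply: ge0_subset_integral => //.
  - by apply/measurable_EFinP; exact: ray_continuous_measurable.
  - by move=> t; rewrite /= in_itv /= andbT lee_fin; exact: f0.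
  - by move=> t; rewrite /= !in_itv /= andbT => /andP[].
rewrite (@continuous_FTC2 _ _ (fun t => k * ln (t + q))) //.
- by rewrite -EFinB lee_fin add0r mulrBr.
- split.
  + by move=> t; rewrite in_itv /= => /andP[t0 _]; case: (dln _ (ltW t0)).
  + by apply: cvg_at_right_filter; exact: FC.
  + by apply: cvg_at_left_filter; apply: FC; exact: ler01.
- move=> t; rewrite in_itv /= => /andP[t0 _].
  by rewrite derive1E; have := dln _ (ltW t0) => -[_ ->].
Qed.

Lemma is_derive_sqrt_shift q (t : R) : 0 <= t -> 0 < q ->
  is_derive t 1 (fun t => Num.sqrt (t + q)) (2 * Num.sqrt (t + q))^-1.
Proof.
move=> t0 q0; have tq : 0 < t + q by lra.
have dc : is_derive t 1 (fun t : R => t + q) 1.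
  by apply: is_derive_eq; rewrite addr0.
have ds := is_derive1_sqrt tq.
have := @is_derive1_comp R Num.sqrt (fun t => t + q) t _ _ ds dc => dd.
by apply: is_derive_eq; rewrite /GRing.scale /= ?mul1r ?mulr1.
Qed.

Lemma ray_continuous_sqrt_shift q : 0 < q -> ray_continuous (fun t => Num.sqrt (t + q)).
Proof.
move=> q0 t t0; have [dF _] := is_derive_sqrt_shift t0 q0.
exact/differentiable_continuous/derivable1_diffP.
Qed.

Lemma cvg_shiftV q : (t + q)^-1 @[t --> +oo%R] --> 0.
Proof.
apply/gtr0_cvgV0.
  near=> t; have : - q < t by near: t; apply: nbhs_pinfty_gt; exact: num_real.
  lra.
exact: cvg_addrr.
Unshelve. all: by end_near. Qed.

Lemma ray_continuousM f g : ray_continuous f -> ray_continuous g ->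
  ray_continuous (fun t => f t * g t).
Proof. by move=> fc gc t t0; apply: cvgM; [exact: fc|exact: gc]. Qed.

Lemma ray_continuousV f : (forall t : R, 0 <= t -> 0 < f t) -> ray_continuous f ->
  ray_continuous (fun t => (f t)^-1).
Proof. by move=> f0 fc t t0; apply: cvgV; [rewrite gt_eqF ?f0|exact: fc]. Qed.

Lemma ray_continuous_shift q : ray_continuous (fun t => t + q).
Proof. by move=> t t0; apply: cvgD; [exact: cvg_id|exact: cvg_cst]. Qed.

Lemma ray_continuous_cst q : ray_continuous (fun=> q).
Proof. by move=> t t0; exact: cvg_cst. Qed.

Lemma ray_continuous_sqrt f : ray_continuous f -> ray_continuous (fun t => Num.sqrt (f t)).
Proof.
by move=> fc t t0; apply: (continuous_comp (fc t t0)); exact: sqrt_continuous.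
Qed.

(** This is (t + q)^(-3/2), whose multiples dominate the integrands of [RF] and [RJ]. *)
Definition tail q (t : R) := (t + q)^-1 * (Num.sqrt (t + q))^-1.

Lemma tail_ge0 q (t : R) : 0 < q -> 0 <= t -> 0 <= tail q t.
Proof. by move=> q0 t0; rewrite mulr_ge0// invr_ge0 ?sqrtr_ge0//; lra. Qed.

Lemma tail_continuous q : 0 < q -> ray_continuous (tail q).
Proof.
move=> q0; apply: ray_continuousM; apply: ray_continuousV => [t t0|].
- lra.
- exact: ray_continuous_shift.
- by rewrite sqrtr_gt0; lra.
- exact: ray_continuous_sqrt_shift.
Qed.

Lemma integral_tail q : 0 < q ->
  (\int[mu]_(t in ray) (tail q t)%:E = (2 / Num.sqrt q)%:E)%E.
Proof.
move=> q0.
have -> : 2 / Num.sqrt q = 0 - (fun t => - 2 * (Num.sqrt (t + q))^-1) 0.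
  by rewrite sub0r add0r mulNr opprK.
apply: (@integral_ray_antiderivative _ (fun t => - 2 * (Num.sqrt (t + q))^-1)).
- by move=> t; exact: tail_ge0.
- exact: tail_continuous.
- move=> t t0; have tq : 0 < t + q by lra.
  have ds := is_derive_sqrt_shift t0 q0.
  have s0 : Num.sqrt (t + q) != 0 by rewrite gt_eqF ?sqrtr_gt0.
  have dV := @is_deriveV R (fun t => Num.sqrt (t + q)) t _ 1 s0 ds.
  apply: is_derive_eq; rewrite /GRing.scale /= /tail.
  have -> : (t + q)^-1 = (Num.sqrt (t + q)) ^- 2 by rewrite sqr_sqrtr// ltW.
  by field.
- rewrite -[0](mulr0 (- 2)); apply: cvgM; first exact: cvg_cst.
  rewrite -(@sqrtr0 R).
  apply: (@cvg_trans _ (Num.sqrt ((t + q)^-1) @[t --> +oo])).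
    apply: near_eq_cvg; near=> t.
    have t0 : 0 <= t by near: t; apply: nbhs_pinfty_ge; exact: num_real.
    by rewrite sqrtrV//; lra.
  apply: continuous_cvg; first exact: sqrt_continuous.
  exact: cvg_shiftV.
Unshelve. all: by end_near. Qed.

(** Up to a constant, the integrand of [RD a y b] without its factor in y. *)
Definition dtail a b (t : R) :=
  (Num.sqrt (t + a))^-1 * (Num.sqrt (t + b))^-1 * (t + b)^-1.

Lemma dtail_ge0 a b (t : R) : 0 < b -> 0 <= t -> 0 <= dtail a b t.
Proof. by move=> b0 t0; rewrite !mulr_ge0// invr_ge0 ?sqrtr_ge0//; lra. Qed.

Lemma dtail_continuous a b : 0 < a -> 0 < b -> ray_continuous (dtail a b).
Proof.
move=> a0 b0; apply: ray_continuousM; [apply: ray_continuousM|];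
  apply: ray_continuousV => [t t0|].
- by rewrite sqrtr_gt0; lra.
- exact: ray_continuous_sqrt_shift.
- by rewrite sqrtr_gt0; lra.
- exact: ray_continuous_sqrt_shift.
- lra.
- exact: ray_continuous_shift.
Qed.

(** An antiderivative is 2/(b - a) times sqrt((t + a)/(t + b)), and the square root tends to 1. The
    value 2/(b - a) (1 - sqrt a / sqrt b) simplifies because b - a = (sqrt b - sqrt a)(sqrt b + sqrt
    a). *)
Lemma integral_dtail a b : 0 < a -> a < b ->
  (\int[mu]_(t in ray) (dtail a b t)%:E
    = (2 / (Num.sqrt b * (Num.sqrt a + Num.sqrt b)))%:E)%E.
Proof.
move=> a0 ab; have b0 : 0 < b by lra.
have [sa sb] : 0 < Num.sqrt a /\ 0 < Num.sqrt b by rewrite !sqrtr_gt0.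
pose F (t : R) := 2 / (b - a) * (Num.sqrt (t + a) * (Num.sqrt (t + b))^-1).
have -> : 2 / (Num.sqrt b * (Num.sqrt a + Num.sqrt b)) = 2 / (b - a) - F 0.
  rewrite /F (add0r a) (add0r b).
  have -> : b - a = (Num.sqrt b) ^+ 2 - (Num.sqrt a) ^+ 2 by rewrite !sqr_sqrtr// ltW.
  have sab : Num.sqrt a < Num.sqrt b by rewrite ltr_sqrt.
  have ba : (Num.sqrt b) ^+ 2 - (Num.sqrt a) ^+ 2 != 0.
    by rewrite !sqr_sqrtr ?ltW// subr_eq0 gt_eqF.
  have ab0 : Num.sqrt a + Num.sqrt b != 0 by rewrite gt_eqF// addr_gt0.
  by field; rewrite ab0 ba gt_eqF.
apply: (@integral_ray_antiderivative _ F).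
- by move=> t; exact: dtail_ge0.
- exact: dtail_continuous.
- move=> t t0; have ta : 0 < t + a by lra. 
  have tb : 0 < t + b by lra.
  have dsa := is_derive_sqrt_shift t0 a0.
  have dsb := is_derive_sqrt_shift t0 b0.
  have s0 : Num.sqrt (t + b) != 0 by rewrite gt_eqF ?sqrtr_gt0.
  have s1 : Num.sqrt (t + a) != 0 by rewrite gt_eqF ?sqrtr_gt0.
  have dV := @is_deriveV R (fun t => Num.sqrt (t + b)) t _ 1 s0 dsb.
  have dM := is_deriveM dsa dV.
  have dZ := is_deriveZ (2 / (b - a)) dM.
  rewrite /F; apply: (is_derive_eq dZ); rewrite /GRing.scale /= /dtail.
  have -> : b - a = (Num.sqrt (t + b)) ^+ 2 - (Num.sqrt (t + a)) ^+ 2.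
    by rewrite !sqr_sqrtr ?ltW//; ring.
  have -> : (t + b)^-1 = (Num.sqrt (t + b)) ^- 2 by rewrite sqr_sqrtr// ltW.
  have ba : (Num.sqrt (t + b)) ^+ 2 - (Num.sqrt (t + a)) ^+ 2 != 0.
    by rewrite !sqr_sqrtr ?ltW// subr_eq0 gt_eqF// ltrD2l.
  by field; rewrite s0 s1 ba.
- rewrite -[X in _ --> X]mulr1; apply: cvgM; first exact: cvg_cst.
  rewrite -(@sqrtr1 R).
  (* Here (t + a)/(t + b) is written as 1 - (b - a)/(t + b) to make the limit visible. *)
  apply: (@cvg_trans _ (Num.sqrt (1 - (b - a) * (t + b)^-1) @[t --> +oo])).
    apply: near_eq_cvg; near=> t.
    have t0 : 0 <= t by near: t; apply: nbhs_pinfty_ge; exact: num_real.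
    have tb : 0 < t + b by lra.
    rewrite -sqrtrV; last lra.
    rewrite -sqrtrM; last lra.
    by congr Num.sqrt; field; rewrite gt_eqF.
  apply: continuous_cvg; first exact: sqrt_continuous.
  rewrite -[X in _ --> X]subr0; apply: cvgB; first exact: cvg_cst.
  rewrite -(mulr0 (b - a)); apply: cvgM; first exact: cvg_cst.
  exact: cvg_shiftV.
Unshelve. all: by end_near. Qed.

End Integrals.

(** * Upper and lower bounds for the elliptic integrals *)

Section CarlsonBounds.
Set Implicit Arguments. Unset Strict Implicit. Unset Printing Implicit Defensive.
Context {R : realType}.
Local Open Scope classical_set_scope.
Implicit Types (x y z p q a b : R).

Local Notation mu := (@lebesgue_measure R).
Local Notation ray := (`[0%R, +oo[%classic : set R).

Definition rsqrt3 x y z (t : R) := (Num.sqrt ((t + x) * (t + y) * (t + z)))^-1.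

Lemma prod3_gt0 x y z (t : R) : 0 < x -> 0 < y -> 0 < z -> 0 <= t ->
  0 < (t + x) * (t + y) * (t + z).
Proof. by move=> *; rewrite !mulr_gt0//; lra. Qed.

Lemma rsqrt3_gt0 x y z (t : R) : 0 < x -> 0 < y -> 0 < z -> 0 <= t -> 0 < rsqrt3 x y z t.
Proof. by move=> *; rewrite invr_gt0 sqrtr_gt0 prod3_gt0. Qed.

Lemma rsqrt3_continuous x y z : 0 < x -> 0 < y -> 0 < z -> ray_continuous (rsqrt3 x y z).
Proof.
move=> x0 y0 z0; apply: ray_continuousV => [t t0|].
  by rewrite sqrtr_gt0 prod3_gt0.
apply: ray_continuous_sqrt.
by apply: ray_continuousM; [apply: ray_continuousM|]; exact: ray_continuous_shift.
Qed.

Lemma rsqrt3_le x y z a b c (t : R) : 0 < a -> 0 < b -> 0 < c -> 0 <= t ->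
  a <= x -> b <= y -> c <= z -> rsqrt3 x y z t <= rsqrt3 a b c t.
Proof.
move=> a0 b0 c0 t0 ax byy cz.
have [x0 y0 z0] : [/\ 0 < x, 0 < y & 0 < z] by split; lra.
rewrite lef_pV2 ?posrE ?sqrtr_gt0 ?prod3_gt0//.
apply: ler_wsqrtr.
by rewrite !ler_pM ?mulr_ge0//; lra.
Qed.

Lemma rsqrt3_eq x y z (t : R) : 0 < x -> 0 < y -> 0 < z -> 0 <= t ->
  rsqrt3 x y z t = (Num.sqrt (t + x))^-1 * (Num.sqrt (t + y))^-1 * (Num.sqrt (t + z))^-1.
Proof.
by move=> x0 y0 z0 t0; rewrite /rsqrt3 !sqrtrM ?mulr_ge0//; lra.
Qed.

Lemma rsqrt3_diag q (t : R) : 0 < q -> 0 <= t -> rsqrt3 q q q t = tail q t.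
Proof.
move=> q0 t0; rewrite rsqrt3_eq// -!invfM -expr2 sqr_sqrtr; last lra.
by rewrite /tail -invfM.
Qed.

Lemma RF_le x y z q : 0 < q -> q <= x -> q <= y -> q <= z ->
  (\int[mu]_(t in ray) (2^-1 * rsqrt3 x y z t)%:E)%E = (RF x y z)%:E /\
  0 <= RF x y z <= (Num.sqrt q)^-1.
Proof.
move=> q0 qx qy qz.
have -> : (Num.sqrt q)^-1 = 2^-1 * (2 / Num.sqrt q).
  by rewrite mulrA mulVf ?mul1r.
apply: ray_integral_le (integral_tail q0) => //.
- move=> t t0; have [x0 y0 z0] : [/\ 0 < x, 0 < y & 0 < z] by split; lra.
  have W0 := ltW (rsqrt3_gt0 x0 y0 z0 t0).
  rewrite mulr_ge0//=.
  by rewrite ler_pM2l// -rsqrt3_diag// rsqrt3_le.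
- by move=> t; exact: tail_ge0.
- move=> t t0; apply: cvgM; first exact: cvg_cst.
  by apply: rsqrt3_continuous => //; lra.
- exact: tail_continuous.
Qed.

Lemma RJ_integrand_continuous x y z p : 0 < x -> 0 < y -> 0 < z -> 0 < p ->
  ray_continuous (fun t => 3 / 2 * rsqrt3 x y z t * (t + p)^-1).
Proof.
move=> x0 y0 z0 p0; apply: ray_continuousM.
  by apply: ray_continuousM; [exact: ray_continuous_cst|exact: rsqrt3_continuous].
apply: ray_continuousV => [t t0|]; first lra.
exact: ray_continuous_shift.
Qed.

Lemma RJ_integrand_ge0 x y z p (t : R) : 0 < x -> 0 < y -> 0 < z -> 0 < p -> 0 <= t ->
  0 <= 3 / 2 * rsqrt3 x y z t * (t + p)^-1.
Proof.
move=> x0 y0 z0 p0 t0; have W0 := ltW (rsqrt3_gt0 x0 y0 z0 t0).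
by rewrite !mulr_ge0// invr_ge0; lra.
Qed.

(** The three square roots contribute at most (t + q)^(-3/2), which is at most q^(-1) (t +
    p)^(-1/2); with the factor 1/(t + p) this is a multiple of [tail p]. Growth of order only
    p^(-1/2) is what makes p [RJ] tend to 0. *)
Lemma RJ_le x y z p q : 0 < p -> p <= q -> q <= x -> q <= y -> q <= z ->
  (\int[mu]_(t in ray) (3 / 2 * rsqrt3 x y z t * (t + p)^-1)%:E)%E = (RJ x y z p)%:E /\
  0 <= RJ x y z p <= 3 / q / Num.sqrt p.
Proof.
move=> p0 pq qx qy qz; have q0 : 0 < q by lra.
have [x0 y0 z0] : [/\ 0 < x, 0 < y & 0 < z] by split; lra.
have -> : 3 / q / Num.sqrt p = 3 / 2 / q * (2 / Num.sqrt p).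
  by field; rewrite !gt_eqF ?sqrtr_gt0.
apply: ray_integral_le (integral_tail p0) => //.
- by rewrite divr_ge0// ltW.
- move=> t t0; rewrite RJ_integrand_ge0//=.
  have -> : 3 / 2 / q * tail p t = 3 / 2 * (q^-1 * (Num.sqrt (t + p))^-1) * (t + p)^-1.
    by rewrite /tail; ring.
  rewrite ler_pM2r; last by rewrite invr_gt0; lra.
  rewrite ler_pM2l; last lra.
  apply: (@le_trans _ _ (tail q t)); first by rewrite -rsqrt3_diag// rsqrt3_le.
  rewrite ler_pM ?invr_ge0 ?sqrtr_ge0//; try lra.
    by rewrite lef_pV2 ?posrE; lra.
  rewrite lef_pV2 ?posrE ?sqrtr_gt0; try lra.
  by apply: ler_wsqrtr; lra.
- by move=> t; exact: tail_ge0.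
- exact: RJ_integrand_continuous.
- exact: tail_continuous.
Qed.

(** On [0, 1] the factor in y is at least 1/sqrt(1 + y), and the factors in x and z together are at
    least 1/(t + s). *)
Lemma RF_ge x y z (s : R) : 0 < x -> 0 < y -> 0 < z -> x <= s -> z <= s ->
  2^-1 / Num.sqrt (1 + y) * (ln (1 + s) - ln s) <= RF x y z.
Proof.
move=> x0 y0 z0 xs zs.
(* This [q] is needed only to obtain finiteness of the integral from [RF_le]. *)
pose q := Num.min x (Num.min y z).
have q0 : 0 < q by rewrite !lt_min x0 y0 z0.
have [qx [qy qz]] : q <= x /\ q <= y /\ q <= z.
  by rewrite !ge_min !lexx !orbT.
have s0 : 0 < s by lra.
apply: (@ray_integral_ge R (fun t => 2^-1 * rsqrt3 x y z t)) => //.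
- by move=> t t0; rewrite mulr_ge0// ltW ?rsqrt3_gt0.
- by apply: ray_continuousM; [exact: ray_continuous_cst|exact: rsqrt3_continuous].
- by have [-> _] := RF_le q0 qx qy qz.
- move=> t /andP[t0 t1]; rewrite -mulrA ler_pM2l//.
  apply: (@le_trans _ _ (rsqrt3 s y s t)); last by rewrite rsqrt3_le.
  rewrite rsqrt3_eq//; try lra.
  have -> : (t + s)^-1 = (Num.sqrt (t + s)) ^- 2 by rewrite sqr_sqrtr//; lra.
  rewrite expr2 invfM (mulrC (Num.sqrt (1 + y))^-1) -!mulrA ler_pM2l; last first.
    by rewrite invr_gt0 sqrtr_gt0; lra.
  rewrite (mulrC (Num.sqrt (t + y))^-1) ler_pM2l; last first.
    by rewrite invr_gt0 sqrtr_gt0; lra.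
  rewrite lef_pV2 ?posrE ?sqrtr_gt0; try lra.
  by apply: ler_wsqrtr; lra.
Qed.

(** On [0, 1] the product under the root is largest at t = 1, which leaves a multiple of 1/(t +
    p). *)
Lemma RJ_ge x y z p : 0 < p -> p <= x -> p <= y -> p <= z ->
  3 / 2 * (Num.sqrt ((1 + x) * (1 + y) * (1 + z)))^-1 * (ln (1 + p) - ln p) <= RJ x y z p.
Proof.
move=> p0 px py pz; have [x0 y0 z0] : [/\ 0 < x, 0 < y & 0 < z] by split; lra.
apply: (@ray_integral_ge R (fun t => 3 / 2 * rsqrt3 x y z t * (t + p)^-1)) => //.
- by move=> t t0; exact: RJ_integrand_ge0.
- exact: RJ_integrand_continuous.
- by have [-> _] := RJ_le p0 (lexx p) px py pz.
- move=> t /andP[t0 t1]; rewrite ler_pM2r ?invr_gt0; last lra.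
  rewrite ler_pM2l; last lra.
  rewrite /rsqrt3 lef_pV2 ?posrE ?sqrtr_gt0 ?prod3_gt0//.
  apply: ler_wsqrtr.
  by rewrite !ler_pM ?mulr_ge0//; lra.
Qed.

(* Replacing 1 / sqrt (t + y) by 1 / sqrt y makes the integrand elementary, and
   1 / sqrt y - 1 / sqrt (t + y) <= sqrt (t + x) / y bounds the error. *)
Lemma RD_bounds x y z
  (v := 3 / (Num.sqrt y * Num.sqrt z * (Num.sqrt x + Num.sqrt z))) :
  0 < x -> x < z -> x <= y ->
  v - 3 / y / Num.sqrt x <= RD x y z <= v.
Proof.
move=> x0 xz xy; have z0 : 0 < z by lra. have y0 : 0 < y by lra.
have sy : 0 < Num.sqrt y by rewrite sqrtr_gt0.
have -> : v = 3 / 2 / Num.sqrt y * (2 / (Num.sqrt z * (Num.sqrt x + Num.sqrt z))).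
  by rewrite /v; field; rewrite !gt_eqF ?addr_gt0 ?sqrtr_gt0.
have fg t : 0 <= t -> 3 / 2 * rsqrt3 x y z t * (t + z)^-1 =
    3 / 2 / Num.sqrt (t + y) * dtail x z t.
  by move=> t0; rewrite rsqrt3_eq//; [|lra..]; rewrite /dtail; ring.
have k0 : 0 <= 3 / 2 / Num.sqrt y by rewrite divr_ge0// ltW.
have fc : ray_continuous (fun t => 3 / 2 * rsqrt3 x y z t * (t + z)^-1).
  by apply: RJ_integrand_continuous => //; lra.
have gc : ray_continuous (dtail x z) by exact: dtail_continuous.
have g0 t : 0 <= t -> 0 <= dtail x z t by exact: dtail_ge0.
have f0 t : 0 <= t -> 0 <= 3 / 2 * rsqrt3 x y z t * (t + z)^-1.
  by move=> t0; apply: RJ_integrand_ge0; lra.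
have fgle t : 0 <= t -> 0 <= 3 / 2 * rsqrt3 x y z t * (t + z)^-1
    <= 3 / 2 / Num.sqrt y * dtail x z t.
  move=> t0; rewrite f0//= fg// ler_wpM2r ?g0//.
  rewrite ler_pM2l; last lra.
  rewrite lef_pV2 ?posrE ?sqrtr_gt0; try lra.
  by apply: ler_wsqrtr; lra.
have [fE /andP[_ RDv]] := ray_integral_le (f := fun t => 3 / 2 * rsqrt3 x y z t * (t + z)^-1)
   k0 fgle g0 fc gc (integral_dtail x0 xz).
rewrite RDv andbT lerBlDr.
have -> : 3 / y / Num.sqrt x = 3 / 2 / y * (2 / Num.sqrt x).
  by field; rewrite !gt_eqF ?sqrtr_gt0.
apply: (ray_integral_le_add _ _ f0 g0 _ fc gc _ _ fE (integral_dtail x0 xz)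
  (integral_tail x0)) => //.
- by rewrite divr_ge0// ltW.
- by move=> t; exact: tail_ge0.
- exact: tail_continuous.
- move=> t t0; rewrite fg// -lerBlDl -mulrBl.
  have ty : 0 < Num.sqrt (t + y) by rewrite sqrtr_gt0; lra.
  have tx : 0 < Num.sqrt (t + x) by rewrite sqrtr_gt0; lra.
  have tz : 0 < Num.sqrt (t + z) by rewrite sqrtr_gt0; lra.
  (* The majorant is split for a comparison factor by factor: the first part bounds the difference
     of inverse roots, the second bounds [dtail x z t]. *)
  have -> : 3 / 2 / y * tail x t = 3 / 2 * (Num.sqrt (t + x) / y) *
     ((Num.sqrt (t + x))^-1 * (Num.sqrt (t + x))^-1 * (t + x)^-1).
    by rewrite /tail; field; rewrite !gt_eqF//; lra.
  rewrite -!mulrBr.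
  have ss : Num.sqrt y <= Num.sqrt (t + y) by apply: ler_wsqrtr; lra.
  have sxz : Num.sqrt (t + x) <= Num.sqrt (t + z) by apply: ler_wsqrtr; lra.
  apply: ler_pM.
  + by rewrite mulr_ge0// subr_ge0 lef_pV2.
  + exact: g0.
  + rewrite ler_pM2l; last lra.
    have -> : (Num.sqrt y)^-1 - (Num.sqrt (t + y))^-1 =
       (Num.sqrt (t + y) - Num.sqrt y) / (Num.sqrt y * Num.sqrt (t + y)).
      by field; rewrite !gt_eqF.
    apply: ler_pM; first by rewrite subr_ge0.
    * by rewrite invr_ge0 mulr_ge0 ?sqrtr_ge0.
    (* Squaring reduces sqrt(t + y) <= sqrt(t + x) + sqrt y to the nonnegativity of x and of the
       cross term. *)
    * rewrite lerBlDr -(@ler_pXn2r _ 2)// ?nnegrE ?sqrtr_ge0 ?addr_ge0 ?sqrtr_ge0//.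
      rewrite sqrrD !sqr_sqrtr; try lra.
      have : 0 <= Num.sqrt (t + x) * Num.sqrt y by rewrite mulr_ge0 ?sqrtr_ge0.
      by rewrite mulr2n; lra.
    * rewrite lef_pV2 ?posrE ?mulr_gt0//.
      rewrite -{1}(sqr_sqrtr (ltW y0)) expr2 ler_pM2l//.
  + rewrite /dtail; apply: ler_pM.
    * by rewrite mulr_ge0// invr_ge0 ltW.
    * by rewrite invr_ge0; lra.
    * by rewrite ler_pM2l ?invr_gt0// lef_pV2.
    * by rewrite lef_pV2 ?posrE; lra.
Qed.

End CarlsonBounds.

(** * Limits at 0+ of the elliptic integrals along the chosen paths *)

Section Limits.
Set Implicit Arguments. Unset Strict Implicit. Unset Printing Implicit Defensive.
Context {R : realType}.
Local Open Scope classical_set_scope.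
Implicit Types (f g F G : R -> R) (c k l x y z : R) (P : {poly R}).

Lemma near0_lt k : 0 < k -> \forall s \near (0 : R)^'+, 0 < s < k.
Proof.
move=> k0; near=> s; apply/andP; split.
- by near: s; exact: nbhs_right_gt.
- by near: s; exact: nbhs_right_lt.
Unshelve. all: by end_near. Qed.

Lemma cvg_ln_lower_bound f k : 0 < k ->
  (\forall s \near 0^'+, k * (ln (1 + s) - ln s) <= f s) -> f s @[s --> 0^'+] --> +oo.
Proof.
move=> k0 kf; apply/cvgryPge => M; near=> s.
have s0 : 0 < s by near: s; exact: nbhs_right_gt.
have : k * (ln (1 + s) - ln s) <= f s by near: s.
apply: le_trans.
have lns : ln s <= - (M / k).
  by near: s; have /cvgrNyPle := @lnNy R; apply.
have ln1 : 0 <= ln (1 + s) by apply: ln_ge0; lra.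
have : k * (M / k) <= k * (ln (1 + s) - ln s) by rewrite ler_pM2l//; lra.
by rewrite mulrCA divff ?mulr1// gt_eqF.
Unshelve. all: by end_near. Qed.

Lemma cvg_sqrt0 k : k * Num.sqrt s @[s --> (0 : R)^'+] --> (0 : R).
Proof.
have s0 : Num.sqrt s @[s --> (0 : R)^'+] --> (0 : R).
  by apply: cvg_at_right_filter; have := @sqrt_continuous R 0; rewrite /continuous_at sqrtr0.
rewrite -[X in _ --> X](mulr0 k); apply: cvgM; [exact: cvg_cst|exact: s0].
Qed.

(** Meant for s times a quantity of order s^(-1/2), as supplied by [RF_le] and [RJ_le]. *)
Lemma squeeze_sqrt0 f k :
  (\forall s \near 0^'+, 0 <= f s <= k * Num.sqrt s) -> f s @[s --> 0^'+] --> 0.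
Proof.
by move=> fk; apply: (squeeze_cvgr fk); [exact: cvg_cst|exact: cvg_sqrt0].
Qed.

Lemma cvg_horner0 P : P.[s] @[s --> 0^'+] --> P.[0].
Proof. by apply: cvg_at_right_filter; exact: continuous_horner. Qed.

Lemma RJ_cvgy x y z : 0 < x -> 0 < y -> 0 < z -> RJ x y z p @[p --> 0^'+] --> +oo.
Proof.
move=> x0 y0 z0.
have m0 : 0 < Num.min x (Num.min y z) by rewrite !lt_min x0 y0 z0.
apply: (@cvg_ln_lower_bound _ (3 / 2 * (Num.sqrt ((1 + x) * (1 + y) * (1 + z)))^-1)).
  by rewrite mulr_gt0 ?divr_gt0// invr_gt0 sqrtr_gt0 !mulr_gt0//; lra.
near=> p.
have /andP[p0] : 0 < p < Num.min x (Num.min y z) by near: p; exact: near0_lt.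
by rewrite !lt_min => /and3P[px py pz]; apply: RJ_ge => //; exact: ltW.
Unshelve. all: by end_near. Qed.

Lemma mulr_RJ_cvg0 x y z : 0 < x -> 0 < y -> 0 < z -> p * RJ x y z p @[p --> 0^'+] --> 0.
Proof.
move=> x0 y0 z0; set q := Num.min x (Num.min y z).
have q0 : 0 < q by rewrite !lt_min x0 y0 z0.
have [qx [qy qz]] : q <= x /\ q <= y /\ q <= z by rewrite !ge_min !lexx !orbT.
apply: (@squeeze_sqrt0 _ (3 / q)); near=> p.
have /andP[p0 pq] : 0 < p < q by near: p; exact: near0_lt.
have [_ /andP[J0 J1]] := RJ_le p0 (ltW pq) qx qy qz.
rewrite mulr_ge0 ?(ltW p0)//=.
apply: (le_trans (ler_wpM2l (ltW p0) J1)).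
by rewrite -{1}(sqr_sqrtr (ltW p0)) le_eqVlt; apply/orP; left; apply/eqP; field;
  rewrite !gt_eqF ?sqrtr_gt0.
Unshelve. all: by end_near. Qed.

Lemma RF_cvgy c y : 0 < c < 1 -> 0 < y -> RF (s * c ^+ 2) y s @[s --> 0^'+] --> +oo.
Proof.
move=> /andP[c0 c1] y0.
apply: (@cvg_ln_lower_bound _ (2^-1 / Num.sqrt (1 + y))).
  by rewrite divr_gt0// sqrtr_gt0; lra.
near=> s; have s0 : 0 < s by near: s; exact: nbhs_right_gt.
by apply: RF_ge => //; [rewrite mulr_gt0 ?exprn_gt0|rewrite ger_pMr ?exprn_ile1// ltW].
Unshelve. all: by end_near. Qed.

Lemma mulr_RF_cvg0 c y : 0 < c < 1 -> 0 < y -> s * RF (s * c ^+ 2) y s @[s --> 0^'+] --> 0.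
Proof.
move=> /andP[c0 c1] y0; apply: (@squeeze_sqrt0 _ c^-1); near=> s.
have /andP[s0 sy] : 0 < s < y by near: s; exact: near0_lt.
have q0 : 0 < s * c ^+ 2 by rewrite mulr_gt0 ?exprn_gt0.
have qs : s * c ^+ 2 <= s by rewrite ger_pMr ?exprn_ile1// ltW.
have [_ /andP[F0 F1]] := RF_le q0 (lexx _) (le_trans qs (ltW sy)) qs.
rewrite mulr_ge0 ?(ltW s0)//=.
apply: (le_trans (ler_wpM2l (ltW s0) F1)).
rewrite sqrtrM ?(ltW s0)// sqrtr_sqr ger0_norm ?(ltW c0)//.
rewrite -{1}(sqr_sqrtr (ltW s0)) le_eqVlt; apply/orP; left; apply/eqP; field.
by rewrite !gt_eqF ?sqrtr_gt0.
Unshelve. all: by end_near. Qed.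

(** With x = s c^2 and z = s, the upper bound of [RD_bounds] multiplied by s is exactly the limit,
    and its error term multiplied by s is 3/(y c) sqrt s. *)
Lemma mulr_RD_cvg c y : 0 < c < 1 -> 0 < y ->
  s * RD (s * c ^+ 2) y s @[s --> 0^'+] --> 3 / (Num.sqrt y * (1 + c)).
Proof.
move=> /andP[c0 c1] y0; set l := 3 / _.
have lcvg : l - 3 / (y * c) * Num.sqrt s @[s --> 0^'+] --> l.
  rewrite -[X in _ --> X]subr0; apply: cvgB; first exact: cvg_cst.
  exact: cvg_sqrt0.
apply: squeeze_cvgr lcvg (@cvg_cst _ l _ _ _); near=> s.
have /andP[s0 sy] : 0 < s < y by near: s; exact: near0_lt.
have q0 : 0 < s * c ^+ 2 by rewrite mulr_gt0 ?exprn_gt0.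
have qs : s * c ^+ 2 < s by rewrite gtr_pMr// exprn_ilt1// ltW.
have /andP[] := RD_bounds q0 qs (le_trans (ltW qs) (ltW sy)).
rewrite sqrtrM ?(ltW s0)// sqrtr_sqr ger0_norm ?(ltW c0)//.
move=> /(ler_wpM2l (ltW s0)) D0 /(ler_wpM2l (ltW s0)) D1.
apply/andP; split; [apply: le_trans D0|apply: (le_trans D1)];
  have := sqr_sqrtr (ltW s0); have : 0 < Num.sqrt s by [rewrite sqrtr_gt0];
  set r := Num.sqrt s => r0 <-;
  rewrite le_eqVlt; apply/orP; left; apply/eqP; rewrite /l; field;
  by rewrite !gt_eqF ?sqrtr_gt0 ?addr_gt0 ?mulr_gt0 ?sqrtr_gt0.
Unshelve. all: by end_near. Qed.

End Limits.

(** * Vanishing and divisibility by X for univariate polynomials *)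

Section UnivariatePolynomials.
Set Implicit Arguments. Unset Strict Implicit. Unset Printing Implicit Defensive.

Lemma poly_vanish_itv01 (R : realFieldType) (P : {poly R}) :
  (forall c, 0 < c < 1 -> P.[c] = 0) -> P = 0.
Proof.
(* The points 1/2, 1/3, ... lie strictly inside ]0, 1[; [size P] of them exceed the number of roots
   of a nonzero [P]. *)
move=> P0; pose r := [seq (i.+2%:R)^-1 : R | i <- iota 0 (size P)].
apply: (@roots_geq_poly_eq0 _ P r); last by rewrite size_map size_iota.
- apply/allP => _ /mapP[i _ ->]; apply/rootP/P0.
  by rewrite invr_gt0 ltr0n invf_lt1 ?ltr0n// ltr1n.
- rewrite map_inj_uniq ?iota_uniq// => i j /invr_inj/eqP.
  by rewrite eqr_nat => /eqP[].
Qed.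

(** General coefficients are wanted because this is applied over [R] and over [{poly R}]. *)
Lemma horner0_mulX (S : comNzRingType) (p : {poly S}) : p.[0] = 0 -> {q | p = q * 'X}.
Proof.
move=> p0; exists (\poly_(i < (size p).-1) p`_i.+1); apply/polyP => -[|i].
  by rewrite coefMX -horner_coef0.
rewrite coefMX coef_poly /=; case: ltnP => // pi.
by rewrite nth_default//; move: pi; case: (size p).
Qed.

Lemma size_mulX_le (S : comNzRingType) (q : {poly S}) (n : nat) :
  (size (q * 'X)%R <= n.+1)%N -> (size q <= n)%N.
Proof. by have [->|q0] := eqVneq q 0; rewrite ?size_poly0// size_mulX. Qed.

End UnivariatePolynomials.

(** * Descent on the powers of s dividing a relation *)

Section Descent.
Set Implicit Arguments. Unset Strict Implicit. Unset Printing Implicit Defensive.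
Context {R : realType}.
Local Open Scope classical_set_scope.
Implicit Types (f g F G : R -> R) (c k l x y z : R) (P Q B C D N : {poly R}).

(** Dividing by [f] gives [P.[s]] = -g/f, which tends to 0 since g stays bounded near 0. *)
Lemma horner0_cvgy f g P l : f s @[s --> 0^'+] --> +oo -> g s @[s --> 0^'+] --> l ->
  (forall s, 0 < s -> P.[s] * f s + g s = 0) -> P.[0] = 0.
Proof.
move=> fy gl Pfg.
have fV : (f s)^-1 @[s --> 0^'+] --> 0.
  apply/gtr0_cvgV0 => //; near=> s; near: s.
  by move/cvgryPgt : fy; apply.
have h : - g s * (f s)^-1 @[s --> 0^'+] --> - l * 0 by apply: cvgM => //; exact: cvgN.
rewrite mulr0 in h.
have Pg : P.[s] @[s --> 0^'+] --> 0.
  apply: cvg_trans h; apply: near_eq_cvg; near=> s.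
  have s0 : 0 < s by near: s; exact: nbhs_right_gt.
  have fs : 0 < f s by near: s; move/cvgryPgt : fy; apply.
  have /eqP := Pfg _ s0; rewrite addrC addr_eq0 => /eqP ->.
  by rewrite opprK mulfK// gt_eqF.
by have /cvg_unique := @cvg_horner0 R P; apply => //; exact: norm_hausdorff.
Unshelve. all: by end_near. Qed.

(** Divergence of [f] gives [C.[0] = 0]. With C = C' X, N(s) = -C'(s) (s f(s)) tends to 0, so X
    divides [N] too, and the relation divided by s involves a smaller [C]. *)
Lemma poly_relation_eq0 f C N : f s @[s --> 0^'+] --> +oo -> s * f s @[s --> 0^'+] --> 0 ->
  (forall s, 0 < s -> C.[s] * f s + N.[s] = 0) -> C = 0.
Proof.
move=> fy sf0; have [n] := ubnP (size C); elim: n C N => // n IH C N + CN.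
rewrite ltnS => Cn.
have C0 : C.[0] = 0 by apply: (horner0_cvgy fy (@cvg_horner0 R N)).
have [C' CE] := horner0_mulX C0.
have N0 : N.[0] = 0.
  have h : - C'.[s] * (s * f s) @[s --> 0^'+] --> - C'.[0] * 0.
    by apply: cvgM => //; apply: cvgN; exact: cvg_horner0.
  rewrite mulr0 in h.
  have /cvg_unique := @cvg_horner0 R N; apply; first exact: norm_hausdorff.
  apply: cvg_trans h; apply: near_eq_cvg; near=> s.
  have s0 : 0 < s by near: s; exact: nbhs_right_gt.
  have := CN _ s0; rewrite CE hornerMX => /eqP; rewrite addrC addr_eq0 => /eqP ->.
  by ring.
have [N' NE] := horner0_mulX N0.
have [C'0|C'0] := eqVneq C' 0; first by rewrite CE C'0 mul0r.
rewrite CE (IH C' N') ?mul0r//.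
  by move: Cn; rewrite CE size_mulX.
move=> s s0; have := CN s s0; rewrite CE NE !hornerMX => h.
by apply: (mulfI (lt0r_neq0 s0)); rewrite mulr0 -[RHS]h; ring.
Unshelve. all: by end_near. Qed.

Lemma poly_vanish_sqr P : (forall c, 0 < c < 1 -> P.[c ^+ 2] = 0) -> P = 0.
Proof.
move=> P0; apply: poly_vanish_itv01 => u /andP[u0 u1].
rewrite -(sqr_sqrtr (ltW u0)); apply: P0; rewrite sqrtr_gt0 u0/=.
by rewrite -[ltRHS]sqrtr1 ltr_sqrt.
Qed.

(* Replacing c by -c separates the even part D(c^2) from the odd part. *)
Lemma even_odd_eq0 B D :
  (forall c, 0 < c < 1 -> 3 * c * B.[c ^+ 2] + (1 + c) * D.[c ^+ 2] = 0) -> B = 0 /\ D = 0.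
Proof.
move=> BD; pose Q := 3%:P * 'X * (B \Po 'X^2) + (1 + 'X) * (D \Po 'X^2).
have Qc c : Q.[c] = 3 * c * B.[c ^+ 2] + (1 + c) * D.[c ^+ 2].
  by rewrite /Q !hornerE !horner_comp !hornerE.
(* Since [Q] is the zero polynomial, the relation may also be evaluated at -c, outside ]0, 1[. *)
have Q0 : Q = 0 by apply: poly_vanish_itv01 => c c01; rewrite Qc BD.
have D0 : D = 0.
  apply: poly_vanish_sqr => c c01; have := Qc c; have := Qc (- c); rewrite Q0 !horner0 sqrrN; lra.
split=> //; apply: poly_vanish_sqr => c /andP[c0 c1]; have := Qc c.
rewrite Q0 D0 !horner0 mulr0 addr0 => h; apply: (mulfI (_ : 3 * c != 0)).
  by rewrite mulf_neq0 ?gt_eqF.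
by rewrite mulr0 h.
Qed.

(** The outer variable is s and the inner one is the ratio a = x / z; the slice fixes a = c^2 and
    leaves a polynomial in s. *)
Definition slice c (P : {poly {poly R}}) : {poly R} := map_poly (horner_eval (c ^+ 2)) P.

Lemma slice_horner c (P : {poly {poly R}}) s : (slice c P).[s] = P.[s%:P].[c ^+ 2].
Proof.
have := horner_map (horner_eval (c ^+ 2)) P s%:P.
by rewrite /= !horner_evalE hornerC.
Qed.

Lemma slice_horner0 c (P : {poly {poly R}}) : (slice c P).[0] = P.[0].[c ^+ 2].
Proof. by rewrite slice_horner. Qed.

Lemma slice_mulX c (P : {poly {poly R}}) s : (slice c (P * 'X)).[s] = (slice c P).[s] * s.
Proof. by rewrite !slice_horner hornerMX hornerM hornerC. Qed.

(** Here [f] and [g] stand for [RF] and [RD] on the path x = s c^2, z = s, and [k] for 1/sqrt y, so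
    that [k / (s * c)] is 1/sqrt(x y z). The induction is on a common bound for the sizes in s. *)
Lemma poly2_relation_eq0 (f g : R -> R -> R) k (A B D : {poly {poly R}}) : 0 < k ->
  (forall c, 0 < c < 1 -> f c s @[s --> 0^'+] --> +oo) ->
  (forall c, 0 < c < 1 -> s * f c s @[s --> 0^'+] --> 0) ->
  (forall c, 0 < c < 1 -> s * g c s @[s --> 0^'+] --> k * (3 / (1 + c))) ->
  (forall c s, 0 < c < 1 -> 0 < s -> (slice c A).[s] * f c s
     + (slice c B).[s] * g c s + (slice c D).[s] * (k / (s * c)) = 0) ->
  [/\ A = 0, B = 0 & D = 0].
Proof.
move=> k0 fy sf0 sg.
have [n [An Bn Dn]] : exists n, [/\ size A <= n, size B <= n & size D <= n]%N.
  by exists (maxn (size A) (maxn (size B) (size D))); rewrite !leq_max !leqnn !orbT.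
elim: n A B D An Bn Dn => [|n IH] A B D An Bn Dn rel.
  by move: Dn Bn An; rewrite !size_poly_leq0 => /eqP-> /eqP-> /eqP->.
have [B0 D0] : B.[0] = 0 /\ D.[0] = 0.
  apply: even_odd_eq0 => c c01; have /andP[c0 _] := c01.
  have h : (slice c A).[s] * (s * f c s) + (slice c B).[s] * (s * g c s)
      + (slice c D).[s] * (k / c) @[s --> 0^'+] -->
      (slice c A).[0] * 0 + (slice c B).[0] * (k * (3 / (1 + c))) + (slice c D).[0] * (k / c).
    apply: cvgD; [apply: cvgD|]; apply: cvgM; try exact: cvg_horner0.
    - exact: sf0.
    - exact: sg.
    - exact: cvg_cst.
  have h0 : (slice c A).[s] * (s * f c s) + (slice c B).[s] * (s * g c s)
      + (slice c D).[s] * (k / c) @[s --> 0^'+] --> 0.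
    apply: (@cvg_trans _ ((cst (0 : R)) s @[s --> (0 : R)^'+])); last exact: cvg_cst.
    apply: near_eq_cvg; near=> s.
    have s0 : 0 < s by near: s; exact: nbhs_right_gt.
    rewrite /= -(mulr0 s) -(rel _ _ c01 s0); field.
    by rewrite !gt_eqF.
  have := cvg_unique _ h h0; rewrite !slice_horner0 => /(_ (@norm_hausdorff _ _)) hE.
  (* The limit relation is this factor times the one required by [even_odd_eq0]. *)
  apply: (mulfI (_ : k / (c * (1 + c)) != 0)).
    by rewrite gt_eqF// divr_gt0// mulr_gt0//; lra.
  rewrite mulr0 -[RHS]hE; field.
  by rewrite !gt_eqF//; lra.
have [B' BE] := horner0_mulX B0; have [D' DE] := horner0_mulX D0.
have A0 : A.[0] = 0.
  apply: poly_vanish_sqr => c c01; have /andP[c0 _] := c01.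
  (* The factor s split off from [B] and [D] turns g into s g and k/(s c) into k/c, so the terms
     beside that of [f] converge. *)
  rewrite -slice_horner0; apply: (horner0_cvgy (fy _ c01)
    (g := fun s => (slice c B').[s] * (s * g c s) + (slice c D').[s] * (k / c))).
    apply: cvgD; apply: cvgM; try exact: cvg_horner0; first exact: sg.
    exact: cvg_cst.
  move=> s s0; rewrite -[RHS](rel _ _ c01 s0) BE DE !slice_mulX; field.
  by rewrite !gt_eqF.
have [A' AE] := horner0_mulX A0.
have le (P P' : {poly {poly R}}) : (size P <= n.+1)%N -> P = P' * 'X -> (size P' <= n)%N.
  by move=> Pn PE; apply: size_mulX_le; rewrite -PE.
suff [A'0 B'0 D'0] : [/\ A' = 0, B' = 0 & D' = 0].
  by rewrite AE BE DE A'0 B'0 D'0 !mul0r.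
apply: IH; [exact: le AE|exact: le BE|exact: le DE|].
move=> c s c01 s0; apply: (mulfI (lt0r_neq0 s0)).
rewrite mulr0 -[RHS](rel _ _ c01 s0) AE BE DE !slice_mulX; ring.
Unshelve. all: by end_near. Qed.

End Descent.

(** * Multivariate polynomials vanishing at all positive points *)

Section MultivariatePolynomials.
Set Implicit Arguments. Unset Strict Implicit. Unset Printing Implicit Defensive.

(** Substitution followed by [e] is again a substitution, and [cancel f e] says that it fixes the
    coefficients. It lets specialized polynomials be evaluated at points. *)
Lemma rmorph_mmap (n : nat) (R S : comNzRingType) (f : {rmorphism R -> S})
    (e : {rmorphism S -> R}) (h : 'I_n -> S) (p : mpoly.mpoly n R) :
  cancel f e -> e (mpoly.mmap f h p) = mpoly.meval (e \o h) p.
Proof.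
move=> fK; rewrite mpoly.mevalE /mpoly.mmap rmorph_sum; apply: eq_bigr => m _.
rewrite rmorphM fK /mpoly.mmap1 rmorph_prod; congr (_ * _).
by apply: eq_bigr => i _; rewrite rmorphXn.
Qed.

Definition mnm_restrict (n : nat) (m : mpoly.multinom n.+1) : mpoly.multinom n :=
  mpoly.Multinom [tuple m (widen_ord (leqnSn n) i) | i < n].

Lemma mnm_restrict_eq (n : nat) (m1 m2 : mpoly.multinom n.+1) :
  (mnm_restrict m1 == mnm_restrict m2) && (m1 ord_max == m2 ord_max) = (m1 == m2).
Proof.
apply/idP/eqP => [/andP[/eqP rm /eqP mm]|->]; last by rewrite !eqxx.
apply/mpoly.mnmP => i; case: (unliftP ord_max i) => [j ->|->] //.
have /mpoly.mnmP /(_ j) := rm; rewrite !mpoly.mnmE.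
by have -> : widen_ord (leqnSn n) j = lift ord_max j
  by apply/val_inj; rewrite /= /bump leqNgt ltn_ord.
Qed.

(** A monomial is determined by its exponent in the last variable and its restriction to the others,
    so exactly one term of [p] can contribute. *)
Lemma muni_coef (n : nat) (R : nzRingType) (p : mpoly.mpoly n.+1 R) m :
  mpoly.mcoeff (mnm_restrict m) (mpoly.muni p)`_(m ord_max) = mpoly.mcoeff m p.
Proof.
rewrite mpoly.muniE coef_sum raddf_sum /=.
transitivity (\sum_(m' <- mpoly.msupp p) mpoly.mcoeff m' p *+ (m' == m)).
  apply: eq_bigr => m' _; rewrite coefZ coefXn -mnm_restrict_eq [m ord_max == _]eq_sym.
  case: eqP => _; last by rewrite mulr0 raddf0 andbF.
  by rewrite mulr1 mpoly.mcoeffZ mpoly.mcoeffX andbT mulr_natr.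
have [ms|ms] := boolP (m \in mpoly.msupp p).
  rewrite (bigD1_seq m) ?mpoly.msupp_uniq//= eqxx mulr1n big1 ?addr0// => m' /negPf ->.
  by rewrite mulr0n.
rewrite big_seq big1 ?mpoly.memN_msupp_eq0// => m' ms'.
by case: eqP => // mE; rewrite mE (negPf ms) in ms'.
Qed.

Definition extend (n : nat) (T : Type) (v : 'I_n -> T) (u : T) (i : 'I_n.+1) : T :=
  if unlift ord_max i is Some j then v j else u.

Lemma muni_horner (n : nat) (R : comNzRingType) (p : mpoly.mpoly n.+1 R) (v : 'I_n -> R) u :
  (map_poly (mpoly.meval v) (mpoly.muni p)).[u] = mpoly.meval (extend v u) p.
Proof.
rewrite mpoly.muniE rmorph_sum /= horner_sum mpoly.mevalE; apply: eq_bigr => m _.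
rewrite map_polyZ map_polyXn hornerZ hornerXn /= mpoly.mevalZ mpoly.mevalX -mulrA.
congr (_ * _); rewrite big_ord_recr /= /extend unlift_none; congr (_ * _).
apply: eq_bigr => i _; rewrite mpoly.mnmE.
have -> : widen_ord (leqnSn n) i = lift ord_max i
  by apply/val_inj; rewrite /= /bump leqNgt ltn_ord.
by rewrite liftK.
Qed.

(** At fixed positive values of the first n variables, [p] is a univariate polynomial in the last
    one that vanishes on ]0, 1[. Each of its coefficients therefore vanishes at all positive points,
    and the induction hypothesis applies to it. *)
Lemma meval_gt0_eq0 (R : realFieldType) (n : nat) (p : mpoly.mpoly n R) :
  (forall v : 'I_n -> R, (forall i, 0 < v i) -> mpoly.meval v p = 0) -> p = 0.
Proof.
elim: n p => [|n IH] p p0.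
  have := p0 (fun=> 1) (fun=> ltr01); rewrite [p]mpoly.nvar0_mpolyC mpoly.mevalC => ->.
  by rewrite mpoly.mpolyC0.
apply/mpoly.mpolyP => m; rewrite -muni_coef mpoly.mcoeff0.
rewrite (IH (mpoly.muni p)`_(m ord_max)) ?mpoly.mcoeff0// => v v0.
suff /polyP/(_ (m ord_max)) : map_poly (mpoly.meval v) (mpoly.muni p) = 0.
  by rewrite coef_map coef0.
apply: poly_vanish_itv01 => u /andP[u0 _]; rewrite muni_horner; apply: p0 => i.
by rewrite /extend; case: unliftP.
Qed.

End MultivariatePolynomials.

(** * Independence over polynomial coefficients *)

Section Independence.
Set Implicit Arguments. Unset Strict Implicit. Unset Printing Implicit Defensive.
Context {R : realType}.
Implicit Types (x y z p s a : R) (A B C D P : mpoly.mpoly 4 R).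

Definition poly_p x y z : mpoly.mpoly 4 R -> {poly R} :=
  mpoly.mmap (@polyC R) (fun i => nth 0 [:: x%:P; y%:P; z%:P; 'X] i).

Lemma poly_p_horner x y z p P : (poly_p x y z P).[p] = mpoly.meval (pt4 x y z p) P.
Proof.
rewrite -[LHS]/(horner_eval p _) rmorph_mmap => [|a]; last exact: hornerC.
by apply: mpoly.meval_eq => -[[|[|[|[|//]]]] i] /=; rewrite /horner_eval ?hornerC ?hornerX.
Qed.

(* The substitution x = s a, z = s, with outer variable s and inner variable a. *)
Definition poly_sa y p : mpoly.mpoly 4 R -> {poly {poly R}} :=
  mpoly.mmap (polyC \o @polyC R)
    (fun i => nth 0 [:: 'X * 'X%:P; y%:P%:P; 'X; p%:P%:P] i).

Lemma poly_sa_horner y p s a P :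
  (poly_sa y p P).[s%:P].[a] = mpoly.meval (pt4 (s * a) y s p) P.
Proof.
rewrite -[LHS]/((horner_eval a \o horner_eval s%:P) _) rmorph_mmap => [|b]; last first.
  by rewrite /= /horner_eval !hornerC.
by apply: mpoly.meval_eq => -[[|[|[|[|//]]]] i] /=; rewrite /horner_eval !hornerE.
Qed.

Lemma carlson_relation_RJ A B C D :
  (forall x y z p, 0 < x -> 0 < y -> 0 < z -> 0 < p ->
     mpoly.meval (pt4 x y z p) A * RF x y z + mpoly.meval (pt4 x y z p) B * RD x y z
     + mpoly.meval (pt4 x y z p) C * RJ x y z p
     + mpoly.meval (pt4 x y z p) D * (Num.sqrt (x * y * z))^-1 = 0) -> C = 0.
Proof.
move=> rel; apply: meval_gt0_eq0 => v v0.
rewrite (@mpoly.meval_eq _ _ _ (pt4 (v 0) (v 1) (v 2) (v 3))).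
  set x := v 0; set y := v 1; set z := v 2; rewrite -poly_p_horner.
  suff -> : poly_p x y z C = 0 by rewrite horner0.
  have [x0 y0 z0] : [/\ 0 < x, 0 < y & 0 < z] by split; exact: v0.
  (* For fixed x, y, z the other three functions are constants in p, so their terms form a
     polynomial in p. *)
  apply: (poly_relation_eq0 (RJ_cvgy x0 y0 z0) (mulr_RJ_cvg0 x0 y0 z0)
    (N := (RF x y z)%:P * poly_p x y z A + (RD x y z)%:P * poly_p x y z B
      + ((Num.sqrt (x * y * z))^-1)%:P * poly_p x y z D)) => p p0.
  rewrite !(hornerD, hornerM, hornerC) !poly_p_horner -[RHS](rel x y z p) //; ring.
by case=> [[|[|[|[|//]]]] i]; congr v; apply/val_inj.
Qed.

Lemma carlson_relation_RF_RD A B D :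
  (forall x y z p, 0 < x -> 0 < y -> 0 < z -> 0 < p ->
     mpoly.meval (pt4 x y z p) A * RF x y z + mpoly.meval (pt4 x y z p) B * RD x y z
     + mpoly.meval (pt4 x y z p) D * (Num.sqrt (x * y * z))^-1 = 0) ->
  [/\ A = 0, B = 0 & D = 0].
Proof.
move=> rel.
have sa0 y p : 0 < y -> 0 < p -> [/\ poly_sa y p A = 0, poly_sa y p B = 0 & poly_sa y p D = 0].
  move=> y0 p0; apply: (@poly2_relation_eq0 R (fun c s => RF (s * c ^+ 2) y s)
    (fun c s => RD (s * c ^+ 2) y s) (Num.sqrt y)^-1).
  - by rewrite invr_gt0 sqrtr_gt0.
  - by move=> c c01; exact: RF_cvgy.
  - by move=> c c01; exact: mulr_RF_cvg0.
  - move=> c c01; have -> : (Num.sqrt y)^-1 * (3 / (1 + c)) = 3 / (Num.sqrt y * (1 + c)).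
      by rewrite invfM; ring.
    exact: mulr_RD_cvg.
  - move=> c s /andP[c0 c1] s0; rewrite !slice_horner !poly_sa_horner.
    rewrite -[RHS](rel (s * c ^+ 2) y s p) ?mulr_gt0 ?exprn_gt0//; congr (_ + _ * _).
    have -> : s * c ^+ 2 * y * s = (s * c) ^+ 2 * y by ring.
    have sc0 : 0 <= s * c by rewrite ltW// mulr_gt0.
    by rewrite sqrtrM ?sqr_ge0// sqrtr_sqr ger0_norm// [RHS]invfM mulrC.
have P0 P : (forall y p, 0 < y -> 0 < p -> poly_sa y p P = 0) -> P = 0.
  move=> h; apply: meval_gt0_eq0 => v v0.
  (* Every positive point is reached by the substitution, with s = z and a = x / z. *)
  rewrite (@mpoly.meval_eq _ _ _ (pt4 (v 2 * (v 0 / v 2)) (v 1) (v 2) (v 3))).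
    by rewrite -poly_sa_horner h// !horner0.
  case=> [[|[|[|[|//]]]] i] /=; rewrite /pt4 /=; last 3 first.
  - by congr v; apply/val_inj.
  - by congr v; apply/val_inj.
  - by congr v; apply/val_inj.
  by rewrite mulrC divfK ?gt_eqF//; congr v; apply/val_inj.
by split; apply: P0 => y p y0 p0; case: (sa0 y p y0 p0).
Qed.

End Independence.

(** * From rational to polynomial coefficients *)

Theorem theorem1 (R : realType)
  (Pa Qa Pb Qb Pc Qc Pd Qd : mpoly.mpoly 4 R) :
  Qa != 0 -> Qb != 0 -> Qc != 0 -> Qd != 0 ->
  (forall x y z p : R, 0 < x -> 0 < y -> 0 < z -> 0 < p ->
     mpoly.meval (pt4 x y z p) Qa != 0 ->
     mpoly.meval (pt4 x y z p) Qb != 0 ->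
     mpoly.meval (pt4 x y z p) Qc != 0 ->
     mpoly.meval (pt4 x y z p) Qd != 0 ->
     rat_eval Pa Qa x y z p * RF x y z
     + rat_eval Pb Qb x y z p * RD x y z
     + rat_eval Pc Qc x y z p * RJ x y z p
     + rat_eval Pd Qd x y z p * (Num.sqrt (x * y * z))^-1 = 0) ->
  Pa = 0 /\ Pb = 0 /\ Pc = 0 /\ Pd = 0.
Proof.
move=> Qa0 Qb0 Qc0 Qd0 rel; set Q := Qa * Qb * Qc * Qd.
have Q0 : Q != 0 by rewrite !mulf_neq0.
(* The relation is multiplied by Q^2 and not just by [Q]: the surviving factor [Q] makes every
   coefficient 0 where some denominator vanishes, so the polynomial relation holds at all positive
   points. *)
have relQ x y z p : 0 < x -> 0 < y -> 0 < z -> 0 < p ->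
   mpoly.meval (pt4 x y z p) (Pa * (Qb * Qc * Qd) * Q) * RF x y z
   + mpoly.meval (pt4 x y z p) (Pb * (Qa * Qc * Qd) * Q) * RD x y z
   + mpoly.meval (pt4 x y z p) (Pc * (Qa * Qb * Qd) * Q) * RJ x y z p
   + mpoly.meval (pt4 x y z p) (Pd * (Qa * Qb * Qc) * Q) * (Num.sqrt (x * y * z))^-1 = 0.
  move=> x0 y0 z0 p0; have := rel _ _ _ _ x0 y0 z0 p0.
  rewrite /rat_eval /Q !mpoly.mevalM.
  set qa := mpoly.meval _ Qa; set qb := mpoly.meval _ Qb.
  set qc := mpoly.meval _ Qc; set qd := mpoly.meval _ Qd.
  have [->|qa0] := eqVneq qa 0; first by move=> _; ring.
  have [->|qb0] := eqVneq qb 0; first by move=> _; ring.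
  have [->|qc0] := eqVneq qc 0; first by move=> _; ring.
  have [->|qd0] := eqVneq qd 0; first by move=> _; ring.
  move=> /(_ isT isT isT isT) h.
  rewrite -[RHS](mulr0 ((qa * qb * qc * qd) ^+ 2)) -h.
  set w := (Num.sqrt _)^-1; field.
  by rewrite qa0 qb0 qc0 qd0.
have cancel P Q' : Q' != 0 -> P * Q' * Q = 0 -> P = 0.
  by move=> Q'0 /eqP; rewrite mulf_eq0 (negPf Q0) orbF mulf_eq0 (negPf Q'0) orbF => /eqP.
have C0 := carlson_relation_RJ relQ.
have [|A0 B0 D0] := carlson_relation_RF_RD (A := Pa * (Qb * Qc * Qd) * Q)
  (B := Pb * (Qa * Qc * Qd) * Q) (D := Pd * (Qa * Qb * Qc) * Q).
  by move=> x y z p x0 y0 z0 p0; rewrite -[RHS](relQ x y z p)// C0 mpoly.meval0 mul0r addr0.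
by do ?split; [apply: cancel A0|apply: cancel B0|apply: cancel C0|apply: cancel D0];
  rewrite !mulf_neq0.
Qed.
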